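(* Let $n$ and $d_1,\ldots,d_n$ be positive integers. Let $\{ |\mathbf{a}_x\rangle \mid x \in \prod_{i=1}^n [d_i]\}$ and $\{ |\mathbf{b}_x\rangle \mid x \in \prod_{i=1}^n [d_i]\}$ be orthonormal tensor-product bases of $\bigotimes_{i=1}^n \mathbb{C}^{d_i}$. Let $\Omega^{(A)} \subseteq \prod_{i=1}^n [d_i]$ and $\Omega^{(B)} \subseteq \prod_{i=1}^n [d_i]$ be downward-closed sets according to the product order on $\prod_{i=1}^n [d_i]$. Then $$\lambda\left(\sum_{x \in \Omega^{(A)}} |\mathbf{a}_x\rangle\langle \mathbf{a}_x| + \sum_{x \in \Omega^{(B)}} |\mathbf{b}_x\rangle\langle \mathbf{b}_x| \right) \preceq \lambda\left(\sum_{x \in \Omega^{(A)}} |\mathbf{e}_x\rangle\langle \mathbf{e}_x| + \sum_{x \in \Omega^{(B)}} |\mathbf{e}_x\rangle\langle \mathbf{e}_x|\right).$$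
   Context: $[d] := \{1,\ldots,d\}$ with its usual order. The product order on $\prod_{i=1}^n [d_i]$ is: $x \leq y$ iff $x_i \leq y_i$ for all $i \in [n]$. A subset $S$ of a partially ordered set $\mathcal{T}$ is downward closed if for all $x \in S$ and $y \in \mathcal{T}$, $y \leq x$ implies $y \in S$. An orthonormal tensor-product basis $\{|\mathbf{a}_x\rangle\}$ of $\bigotimes_{i=1}^n \mathbb{C}^{d_i}$ is one of the form $|\mathbf{a}_x\rangle = \bigotimes_{i=1}^n |a_{i,x_i}\rangle$ for $x \in \prod_{i=1}^n [d_i]$, where for each $i \in [n]$, $\{|a_{i,j}\rangle\}_{j=1}^{d_i}$ is an orthonormal basis of $\mathbb{C}^{d_i}$; similarly for $\{|\mathbf{b}_x\rangle\}$ with orthonormal bases $\{|b_{i,j}\rangle\}_{j=1}^{d_i}$. $|e_j\rangle$ denotes the $j$th standard basis vector of $\mathbb{C}^{d_i}$, and $|\mathbf{e}_x\rangle := \bigotimes_{i=1}^n |e_{x_i}\rangle$. For a unit vector $|v\rangle$, $|v\rangle\langle v|$ is the orthogonal projector onto its span. For a self-adjoint operator $X$ on a complex inner product space of finite dimension $d$, $\lambda(X) = (\lambda_1(X),\ldots,\lambda_d(X))$ is the vector of its eigenvalues with multiplicity in nonincreasing order. For $x, y \in \mathbb{R}^d$, $y \preceq x$ means: for each $k \in \{1,\ldots,d-1\}$ the sum of the $k$ largest coordinates of $x$ is greater than or equal to the sum of the $k$ largest coordinates of $y$, and $\sum_{i=1}^d x_i = \sum_{i=1}^d y_i$. *)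

(* Defs.v *)
From mathcomp Require Import all_boot all_order all_algebra.
From mathcomp Require Import sesquilinear spectral.
From mathcomp Require Import reals complex.

Set Implicit Arguments.
Unset Strict Implicit.
Unset Printing Implicit Defensive.

Import Order.TTheory GRing.Theory Num.Theory.
Local Open Scope ring_scope.
Local Open Scope sesquilinear_scope.

(* [d_i] = {1, .., d_i} is represented by 'I_(d i) = {0, .., d_i - 1}. *)
Notation multi_index d := {dffun forall i, 'I_(d i)}.

Definition prod_le n (d : 'I_n -> nat) : rel (multi_index d) :=
  fun x y => [forall i, (x i <= y i)%N].

Definition downward_closed (T : finType) (le : rel T) (S : {set T}) : Prop :=
  forall x y : T, x \in S -> le y x -> y \in S.

Section Quantum.
Variable R : realType.
Local Notation C := R[i].

(* Kets are column vectors; <u|v> is conjugate-linear in u. *)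
Definition braket m (u v : 'cV[C]_m) : C := (u^t* *m v) 0 0.

(* |v><v| *)
Definition projector m (v : 'cV[C]_m) : 'M[C]_m := v *m v^t*.

Definition orthonormal_basis m (v : 'I_m -> 'cV[C]_m) : Prop :=
  (forall j k, braket (v j) (v k) = (j == k)%:R) /\
  (forall w : 'cV[C]_m, exists c : 'I_m -> C, w = \sum_(j < m) c j *: v j).

(* The tensor product of the spaces C^(d i) is the coordinate space whose
   coordinates are labelled by the multi-indices, enumerated by enum_val:
   coordinate y of the tensor product of the v i is the product of the
   coordinates y i of the v i.  In particular the tensor products of standard
   basis vectors are the standard basis vectors, and inner products are
   multiplicative over tensor products of vectors. *)
Definition tensor n (d : 'I_n -> nat) (v : forall i, 'cV[C]_(d i)) :
    'cV[C]_#|multi_index d| :=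
  \col_k \prod_(i < n) v i ((enum_val k : multi_index d) i) 0.

Definition tensor_onb n (d : 'I_n -> nat)
    (a : multi_index d -> 'cV[C]_#|multi_index d|) : Prop :=
  exists f : forall i, 'I_(d i) -> 'cV[C]_(d i),
    (forall i, orthonormal_basis (f i)) /\
    (forall x, a x = tensor (fun i => f i (x i))).

Definition std_tensor n (d : 'I_n -> nat) (x : multi_index d) :
    'cV[C]_#|multi_index d| :=
  tensor (fun i => delta_mx (x i) 0).

Definition sort_desc (s : seq R) : seq R := sort >=%R s.

(* Roots of the characteristic polynomial, with multiplicity. *)
Definition eigenvalues m (X : 'M[C]_m) : seq C :=
  sval (closed_field_poly_normal (char_poly X)).

(* Meant for self-adjoint X: the eigenvalues are then real, so that taking real
   parts loses nothing, and there are m of them, so that the default value of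
   nth is not used. *)
Definition lambda m (X : 'M[C]_m) : 'rV[R]_m :=
  \row_(i < m) nth 0 (sort_desc [seq complex.Re z | z <- eigenvalues X]) i.

Definition sum_largest m (k : nat) (x : 'rV[R]_m) : R :=
  \sum_(t <- take k (sort_desc [seq x 0 i | i : 'I_m])) t.

(* y is majorized by x. *)
Definition majorized m (y x : 'rV[R]_m) : Prop :=
  (forall k : nat, (0 < k < m)%N -> sum_largest k y <= sum_largest k x) /\
  \sum_(i < m) x 0 i = \sum_(i < m) y 0 i.

End Quantum.

(* Main.v *)
Require Import Defs.
From mathcomp Require Import all_boot all_order all_algebra.
From mathcomp Require Import sesquilinear spectral.
From mathcomp Require Import reals complex.
From mathcomp Require Import ring lra.

(** Write P and Q for the orthogonal projectors onto the spans of the a_x with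
x in OmegaA and of the b_x with x in OmegaB, and r for the cardinality of the
intersection of OmegaA and OmegaB.  When both bases are the standard one, P + Q
is diagonal with entries 0, 1, 2, so its k largest eigenvalues add up to
min(k, c) + min(k, r), where c is the cardinality of the union.  As P + Q
always has nonnegative spectrum and trace c + r, the bound is automatic once
k >= c; for k <= c it says that the k largest eigenvalues add up to at most
k + min(k, r).  No eigenvalue exceeds 2, so this follows if at most r of them
exceed 1.

The number of eigenvalues above 1 is at most the rank of PQ: on the span of the
corresponding eigenvectors the quadratic form of P + Q exceeds that of the
identity, whereas a vector y with PQy = 0 satisfies
<y, (1 - P - Q) y> = |(1 - P - Q) y|^2 >= 0
(spectrum_add_orthoprojectors).

It remains to see that PQ has rank at most r (rank_mul_proj_on).  This is where
the tensor structure and downward closure enter.  In each factor the matrix of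
inner products <a_{i,j}|b_{i,k}> is a product L_i U_i with U_i upper triangular
and the nonzero columns of L_i having their leading entries in distinct rows
(echelon_factorization, essentially the Bruhat decomposition).  Tensoring, the
matrix of the <a_x|b_y> is a sum over multi-indices z of rank-one matrices,
whose term z is supported on the y >= z and on the x >= w(z), where w acts
coordinatewise and injectively.  Restricted to x in OmegaA and y in OmegaB,
only the z in OmegaB with w(z) in OmegaA survive, by downward closure; and
there are at most r of those, because replacing the coordinates of w by the
identity one after the other can only increase their number
(card_below_straighten): on a line parallel to an axis, the condition becomes
that of lying in two initial segments, which are nested. *)

Set Implicit Arguments.
Unset Strict Implicit.
Unset Printing Implicit Defensive.

Import Order.TTheory GRing.Theory Num.Theory.
Local Open Scope ring_scope.

(** * Coordinatewise injections and downward closed sets *)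

Section Rearrangement.
Variables (n : nat) (d : 'I_n -> nat).
Local Notation T := (multi_index d).
Implicit Types (x y z : T) (A B : {set T}).

(** Membership in the downward closure of A inside all of N^n: the values of the
injections below may leave the box in which A lives. *)
Definition below A (u : 'I_n -> nat) :=
  [exists x in A, [forall i, (u i <= x i)%N]].

Lemma belowP A u :
  reflect (exists2 x, x \in A & forall i, (u i <= x i)%N) (below A u).
Proof.
apply: (iffP existsP) => [[x /andP[xA /forallP ux]]|[x xA ux]]; exists x => //.
by rewrite xA; apply/forallP.
Qed.

Lemma below_le A u v : (forall i, (u i <= v i)%N) -> below A v -> below A u.
Proof.
move=> uv /belowP[x xA vx]; apply/belowP; exists x => // i.
exact: leq_trans (uv i) (vx i).
Qed.

Lemma below_downward_closed A x : downward_closed (@prod_le n d) A ->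
  below A (fun i => x i) = (x \in A).
Proof.
move=> hA; apply/belowP/idP => [[y yA xy]|xA]; last by exists x.
by apply: (hA y) => //; apply/forallP.
Qed.

(** The count decomposes over the lines in direction i.  On such a line,
membership in B and, since v' i is the identity, the condition on A are both
initial segments, hence nested.  If the segment of B is the smaller one, the
right-hand set is all of B there.  Otherwise it is the whole segment of A, and
moving coordinate i of z to v i (z i) injects the left-hand set into it. *)
Lemma card_below_straighten A B (i : 'I_n) (v v' : forall j, 'I_(d j) -> nat) :
  downward_closed (@prod_le n d) B ->
  injective (v i) -> (forall k, v' i k = k) ->
  (forall j, j != i -> v' j =1 v j) ->
  (#|[set z in B | below A (fun j => v j (z j))]| <=
   #|[set z in B | below A (fun j => v' j (z j))]|)%N.
Proof.
move=> hB vi_inj v'i v'j.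
pose line z := [set y : T | [forall j, (j != i) ==> (y j == z j)]].
have lineP z y : line z = line y -> forall j, j != i -> z j = y j.
  move=> E j ji; have: z \in line y.
    by rewrite -E inE; apply/forallP => k; rewrite eqxx implybT.
  by rewrite inE => /forallP/(_ j); rewrite ji => /eqP.
have lineE z y : (forall j, j != i -> z j = y j) -> line z = line y.
  move=> E; apply/setP => t; rewrite !inE; apply: eq_forallb => j.
  by case: (altP (j =P i)) => //= ji; rewrite E.
rewrite -!sum1_card (partition_big line xpredT) //=.
rewrite [leqRHS](partition_big line xpredT) //=.
apply: leq_sum => C _; rewrite !sum1dep_card.
(* First case: on the line C, the segment of B lies inside that of A. *)
have [/forallP allA|] := boolP [forall z, (z \in B) && (line z == C) ==>
    below A (fun j => v' j (z j))].
  apply/subset_leq_card/subsetP => z; rewrite !inE.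
  move=> /andP[/andP[zB _] zC]; have := allA z.
  by rewrite zB zC /= => ->.
rewrite negb_forall => /existsP[z0]; rewrite negb_imply.
move=> /andP[/andP[z0B /eqP z0C] nA].
(* The default value of insubd is not reached on the points counted, where
   v i (z i) is at most a coordinate of an element of A. *)
pose phi z : T := [ffun j => dfwith (T := fun j => 'I_(d j)) z
   (insubd (z i) (v i (z i))) j].
have phi_out z j : j != i -> phi z j = z j.
  by move=> ji; rewrite ffunE dfwith_out // eq_sym.
have phi_in z : below A (fun j => v j (z j)) -> phi z i = v i (z i) :> nat.
  move=> /belowP[x xA /(_ i) le_x]; rewrite ffunE dfwith_in val_insubd.
  by rewrite (leq_ltn_trans le_x).
rewrite -(@card_in_imset _ _ phi); last first.
  move=> z y; rewrite !inE => /andP[/andP[_ zA] /eqP zC].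
  move=> /andP[/andP[_ yA] /eqP yC] E.
  apply/ffunP => j; have [->|ji] := eqVneq j i; last first.
    by apply: lineP ji; rewrite zC yC.
  by apply: vi_inj; rewrite -(phi_in _ zA) -(phi_in _ yA) E.
apply/subset_leq_card/subsetP => y /imsetP[z].
rewrite !inE => /andP[/andP[_ zA] /eqP zC] ->.
have lphi : line (phi z) = C by rewrite -zC; apply: lineE => j /phi_out.
have phiA : below A (fun j => v' j (phi z j)).
  move: (zA); apply: below_le => j.
  have [->|ji] := eqVneq j i; first by rewrite v'i phi_in.
  by rewrite phi_out // v'j.
rewrite lphi eqxx phiA !andbT.
(* z0 is in B but beyond the segment of A, so phi z precedes it. *)
apply: (hB z0) => //; apply/forallP => j.
have [->|ji] := eqVneq j i; last first.
  by rewrite (lineP (phi z) z0) // lphi z0C.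
rewrite leqNgt; apply: contra nA => /ltnW lt_z0.
move: phiA; apply: below_le => k.
have [->|ki] := eqVneq k i; first by rewrite !v'i.
by rewrite (lineP (phi z) z0) // lphi z0C.
Qed.

Lemma card_below_le A B (w : forall i, 'I_(d i) -> nat) :
  downward_closed (@prod_le n d) A -> downward_closed (@prod_le n d) B ->
  (forall i, injective (w i)) ->
  (#|[set z in B | below A (fun i => w i (z i))]| <= #|A :&: B|)%N.
Proof.
move=> hA hB w_inj.
(* v k uses w in the coordinates below k and the identity in the others. *)
pose v k i (j : 'I_(d i)) : nat := if (i < k)%N then w i j else j.
have main k : (k <= n)%N ->
  (#|[set z in B | below A (fun i => v k i (z i))]| <= #|A :&: B|)%N.
  elim: k => [_|k IH lt_kn].
    apply/subset_leq_card/subsetP => z; rewrite !inE /v /= => /andP[-> ].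
    by rewrite below_downward_closed // andbT.
  apply: leq_trans (IH (ltnW lt_kn)).
  apply: (@card_below_straighten A B (Ordinal lt_kn)) => //.
  - by move=> j1 j2; rewrite /v /= ltnSn => /w_inj.
  - by move=> j; rewrite /v /= ltnn.
  - move=> j; rewrite -val_eqE /= => jk t; rewrite /v ltnS.
    by rewrite [in RHS]leq_eqVlt (negPf jk).
apply: leq_trans (main n (leqnn n)).
apply/subset_leq_card/subsetP => z; rewrite !inE => /andP[-> ] /=.
by apply: below_le => i; rewrite /v ltn_ord.
Qed.

End Rearrangement.

(** * Triangular factorization of matrices *)

Section Elimination.
Variable F : fieldType.

(** Gaussian elimination, one column at a time from the left: if i is the first
row with a nonzero entry in the current column c, subtracting the rank-one
matrix (column c) (row i) / (entry i c) clears both column c and row i.  The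
column used starts at row i, the row used at column c, and a cleared row stays
zero, so that it is never chosen again. *)
Lemma echelon_factorization m n (M : 'M[F]_(m, n)) :
  exists (L : 'M_(m, n)) (U : 'M_n) (w : 'I_n -> nat),
  [/\ M = L *m U, injective w,
      forall x j, L x j != 0 -> (w j <= x)%N &
      forall j y, U j y != 0 -> (j <= y)%N].
Proof.
(* The induction is on the number k of columns still to be cleared, all earlier
   ones being zero; nonzero rows of M are the only candidates for pivot rows. *)
suff aux k : forall M : 'M[F]_(m, n),
    (forall x (y : 'I_n), (y + k < n)%N -> M x y = 0) ->
  exists (L : 'M_(m, n)) (U : 'M_n) (w : 'I_n -> nat),
  [/\ M = L *m U /\ injective w,
      forall x j, L x j != 0 -> (w j <= x)%N,
      forall j y, U j y != 0 -> (j <= y)%N,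
      forall j (x : 'I_m), w j = x -> exists y, M x y != 0 &
      forall x (j : 'I_n), (j + k < n)%N -> L x j = 0].
  have [|L [U [w [[]]]]] := aux n M; last by exists L, U, w.
  by move=> x y; rewrite ltnNge leq_addl.
elim: k {M} => [|k IH] M M0.
  (* Columns without a pivot get a fictitious row beyond the matrix. *)
  exists 0, 0, (fun j => m + j)%N; split=> //.
  - split; last by move=> j1 j2 /addnI/val_inj.
    by apply/matrixP => x y; rewrite mul0mx M0 ?addn0 // mxE.
  - by move=> x j; rewrite mxE eqxx.
  - by move=> x j; rewrite mxE eqxx.
  - by move=> j x E; have := ltn_ord x; rewrite -E ltnNge leq_addr.
  - by move=> x j _; rewrite mxE.
have [lt_kn|le_nk] := ltnP k n; last first.
  have [|L [U [w [? ? ? ? L0]]]] := IH M.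
    by move=> x y; rewrite ltnNge (leq_trans le_nk) ?leq_addl.
  exists L, U, w; split=> // x j.
  by rewrite ltnNge (leq_trans le_nk) // addnS leqW // leq_addl.
have lt_cn : (n - k.+1 < n)%N by rewrite ltn_subrL (leq_ltn_trans _ lt_kn).
pose c := Ordinal lt_cn.
have ck : (c + k.+1)%N = n by rewrite /= subnK.
have ltc (y : 'I_n) : (y + k < n)%N -> y != c -> (y + k.+1 < n)%N.
  rewrite -[X in (_ < X)%N]ck addnS ltnS leq_add2r => yc nyc.
  by rewrite -[X in (_ < X)%N]ck ltn_add2r ltn_neqAle nyc.
have lec (y : 'I_n) : (y + k.+1 < n)%N -> (y + k < n)%N /\ y != c.
  move=> H; split; first by apply: leq_trans H; rewrite addnS.
  by apply: contraTneq H => ->; rewrite ck ltnn.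
have [/forallP col0|] := boolP [forall x, M x c == 0].
  have [|L [U [w [? ? ? ? L0]]]] := IH M.
    move=> x y lty; have [->|yc] := eqVneq y c; first exact/eqP/col0.
    exact/M0/ltc.
  by exists L, U, w; split=> // x j /lec[]/L0.
rewrite negb_forall => /existsP[i0 Mi0].
case: (@arg_minnP _ i0 (fun i => M i c != 0) (fun i : 'I_m => i : nat) Mi0).
move=> i Mi i_min.
pose N : 'M_(m, n) := \matrix_(x, y) (M x y - M x c * (M i y / M i c)).
have [|L [U [w [[NE w_inj] Lw Uw wN L0]]]] := IH N.
  move=> x y lty; rewrite mxE; have [->|yc] := eqVneq y c.
    by rewrite divff // mulr1 subrr.
  by rewrite (M0 x y) ?ltc // (M0 i y) ?ltc // mul0r mulr0 subrr.
exists (\matrix_(x, j) if j == c then M x c else L x j).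
exists (\matrix_(j, y) if j == c then M i y / M i c else U j y).
exists (fun j => if j == c then i : nat else w j); split.
- split.
    apply/matrixP => x y; rewrite !mxE (bigD1 c) //= !mxE eqxx.
    have /matrixP/(_ x y) := NE; rewrite !mxE => /eqP.
    rewrite subr_eq addrC => /eqP->; congr (_ + _).
    rewrite (bigD1 c) //= L0; last by rewrite -addnS ck.
    by rewrite mul0r add0r; apply: eq_bigr => j jc; rewrite !mxE (negPf jc).
  have w_i j : w j <> i.
    move=> /wN[y]; rewrite mxE mulrC divfK ?subrr ?eqxx //.
  move=> j1 j2; case: eqVneq => [->|_]; case: eqVneq => [->|_] //.
  + by move/esym/w_i.
  + by move/w_i.
  + exact: w_inj.
- move=> x j; rewrite mxE.
  by have [_|_] := eqVneq j c; [apply: i_min|apply: Lw].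
- move=> j y; rewrite mxE; have [->|_] := eqVneq j c; last exact: Uw.
  apply: contraNT; rewrite -ltnNge => lt_yc.
  by rewrite M0 ?mul0r // -[X in (_ < X)%N]ck ltn_add2r.
- move=> j x; case: eqVneq => [_ /val_inj<-|_ /wN]; first by exists c.
  case=> y; rewrite mxE; have [->|] := eqVneq (M x y) 0; last by exists y.
  by exists c; apply: contraNneq p => ->; rewrite mul0r subrr.
- by move=> x j /lec[jk jc]; rewrite mxE (negPf jc) L0.
Qed.

End Elimination.

(** * The rank of the product of two tensor projectors *)

Lemma prod_sum_dffun (R : comPzSemiRingType) (I : finType) (J : I -> finType)
    (G : forall i, J i -> R) :
  \prod_i \sum_(j : J i) G i j =
  \sum_(t : {dffun forall i, J i}) \prod_i G i (t i).
Proof.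
under eq_bigr do rewrite big_tag.
rewrite bigA_distr_big_dep.
have := @big_fprod R 0 1 *%R +%R I J (fun i => [ffun j => G i j]).
rewrite (reindex (@fprod_of_dffun _ J)); last exact/onW_bij/fprod_of_dffun_bij.
move=> E; transitivity (\sum_(t : {dffun forall i, J i})
   \prod_(i in I) [ffun j => G i j] (fprod_of_dffun t i)).
  rewrite E; apply: eq_bigr => g _; apply: eq_bigr => i _.
  by rewrite /untag; case: eqP => // e; rewrite ffunE.
by apply: eq_bigr => t _; apply: eq_bigr => i _; rewrite ffunE fprodE.
Qed.

Lemma mxrank_sum_leq (F : fieldType) (I : finType) (S : {set I}) m n
    (u : I -> 'cV[F]_m) (v : I -> 'rV[F]_n) :
  (\rank (\sum_(z in S) u z *m v z)%R <= #|S|)%N.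
Proof.
rewrite -sum1_card; elim/big_rec2: _ => [|z r M _ le_Mr].
  by rewrite mxrank0.
apply: leq_trans (mxrank_add _ _) _; apply: leq_add le_Mr.
exact: mulmx_max_rank.
Qed.

Local Open Scope sesquilinear_scope.

Section Tensor.
Variables (R : realType) (n : nat) (d : 'I_n -> nat).
Local Notation C := R[i].
Local Notation T := (multi_index d).

Lemma braketE m (u v : 'cV[C]_m) : u^t* *m v = (braket u v)%:M.
Proof. by rewrite [LHS]mx11_scalar. Qed.

Lemma braket_tensor (u v : forall i, 'cV[C]_(d i)) :
  braket (tensor u) (tensor v) = \prod_i braket (u i) (v i).
Proof.
transitivity (\prod_i \sum_(j < d i) ((u i j 0)^* * v i j 0)); last first.
  apply: eq_bigr => i _; rewrite /braket mxE; apply: eq_bigr => j _.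
  by rewrite !mxE.
rewrite prod_sum_dffun /braket mxE.
rewrite [RHS](big_enum_val (A := T)) /=; apply: eq_bigr => k _.
by rewrite !mxE rmorph_prod big_split.
Qed.

Lemma braket_tensor_onb (a : T -> 'cV[C]_#|{: T}|) :
  tensor_onb a -> forall x y, braket (a x) (a y) = (x == y)%:R.
Proof.
case=> f [f_onb af] x y; rewrite !af braket_tensor.
under eq_bigr => i _ do rewrite (proj1 (f_onb i)).
have [->|nxy] := eqVneq x y; first by rewrite big1 // => i _; rewrite eqxx.
have [i xyi] : exists i, x i != y i.
  apply/existsP; apply: contra_neqT nxy => /existsPn E.
  by apply/ffunP => i; apply/eqP/negPn/E.
by rewrite (bigD1 i) //= (negPf xyi) mul0r.
Qed.

Definition proj_on (A : {set T}) (a : T -> 'cV[C]_#|{: T}|) :=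
  \sum_(x in A) projector (a x).

(** Factoring the matrices of inner products in each tensor factor writes PQ as a
sum of rank-one matrices indexed by multi-indices z; downward closure of A and
B makes the terms vanish unless z is in B and w(z) is below A. *)
Lemma rank_mul_proj_on (a b : T -> 'cV[C]_#|{: T}|) (A B : {set T}) :
  tensor_onb a -> tensor_onb b ->
  downward_closed (@prod_le n d) A -> downward_closed (@prod_le n d) B ->
  (\rank (proj_on A a *m proj_on B b) <= #|A :&: B|)%N.
Proof.
move=> [f [_ af]] [g [_ bg]] hA hB.
pose M i : 'M[C]_(d i) := \matrix_(j, k) braket (f i j) (g i k).
have /fin_all_exists[L /fin_all_exists[U /fin_all_exists[w LUw]]] :=
  fun i => echelon_factorization (M i).
pose l z x := \prod_i L i (x i) (z i).
pose u z y := \prod_i U i (z i) (y i).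
have abE x y : braket (a x) (b y) = \sum_(z : T) l z x * u z y.
  rewrite af bg braket_tensor.
  under [RHS]eq_bigr do rewrite -big_split.
  rewrite -(prod_sum_dffun (fun i j => L i (x i) j * U i j (y i))).
  apply: eq_bigr => i _; case: (LUw i) => /matrixP/(_ (x i) (y i)).
  by rewrite !mxE.
have l0 z x : x \in A -> ~~ below A (fun i => w i (z i)) -> l z x = 0.
  move=> xA; apply: contraNeq => /prodf_neq0 lz; apply/belowP; exists x => // i.
  by case: (LUw i) => _ _ + _; apply; apply: lz.
have u0 z y : y \in B -> z \notin B -> u z y = 0.
  move=> yB; apply: contraNeq => /prodf_neq0 uz; apply: (hB y) => //.
  by apply/forallP => i; case: (LUw i) => _ _ _; apply; apply: uz.
have w_inj i : injective (w i) by case: (LUw i).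
apply: leq_trans (card_below_le hA hB w_inj).
set S := [set z in B | _].
suff -> : proj_on A a *m proj_on B b = \sum_(z in S)
    (\sum_(x in A) l z x *: a x) *m (\sum_(y in B) u z y *: (b y)^t*).
  exact: mxrank_sum_leq.
transitivity (\sum_(z : T)
    (\sum_(x in A) l z x *: a x) *m (\sum_(y in B) u z y *: (b y)^t*)).
  under [RHS]eq_bigr do rewrite mulmx_suml.
  rewrite exchange_big mulmx_suml /=; apply: eq_bigr => x _.
  under [RHS]eq_bigr do rewrite mulmx_sumr.
  rewrite exchange_big mulmx_sumr /=; apply: eq_bigr => y _.
  rewrite /projector mulmxA -[a x *m _ *m b y]mulmxA braketE mul_mx_scalar.
  rewrite abE scaler_suml mulmx_suml; apply: eq_bigr => z _.
  by rewrite -!scalemxAl -scalemxAr scalerA.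
rewrite [RHS]big_mkcond; apply: eq_bigr => z _; case: ifPn => //.
rewrite inE negb_and => /orP[zB|zA].
  by rewrite [X in _ *m X]big1 ?mulmx0 // => y yB; rewrite u0 ?scale0r.
by rewrite [X in X *m _]big1 ?mul0mx // => x xA; rewrite l0 ?scale0r.
Qed.

Lemma adj_proj_on A a : (proj_on A a)^t* = proj_on A a.
Proof.
rewrite /proj_on !raddf_sum /=; apply: eq_bigr => x _.
by rewrite /projector trmx_mul map_mxM trmxCK.
Qed.

Lemma idem_proj_on A a : tensor_onb a ->
  proj_on A a *m proj_on A a = proj_on A a.
Proof.
move=> /braket_tensor_onb a_on; rewrite mulmx_suml; apply: eq_bigr => x xA.
rewrite mulmx_sumr (bigD1 x) //= big1 => [|y /andP[_ yx]].
  rewrite /projector mulmxA -[_ *m _ *m a x]mulmxA braketE a_on eqxx.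
  by rewrite mulmx1 addr0.
rewrite /projector mulmxA -[_ *m _ *m a y]mulmxA braketE a_on eq_sym (negPf yx).
by rewrite mul_mx_scalar scale0r mul0mx.
Qed.

Lemma tr_proj_on A a : tensor_onb a -> \tr (proj_on A a) = #|A|%:R.
Proof.
move=> /braket_tensor_onb a_on.
rewrite raddf_sum /= -[in RHS]sum1_card natr_sum.
apply: eq_bigr => x _.
by rewrite /projector mxtrace_mulC braketE a_on eqxx mxtrace1.
Qed.

End Tensor.

(** * Spectra and sums of largest eigenvalues *)

Lemma char_poly_conjugate (F : comNzRingType) m (W V D : 'M[F]_m) :
  W *m V = 1%:M -> char_poly (W *m D *m V) = char_poly D.
Proof.
move=> WV1; pose f := map_mx (@polyC F).
have fWV1 : f m m W *m f m m V = 1%:M by rewrite -map_mxM WV1 map_mx1.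
rewrite /char_poly /char_poly_mx !map_mxM /=.
have -> : 'X%:M - f m m W *m f m m D *m f m m V =
    f m m W *m ('X%:M - f m m D) *m f m m V.
  rewrite mulmxBr mulmxBl; congr (_ - _).
  by rewrite mul_mx_scalar -scalemxAl fWV1 scalemx1.
rewrite !det_mulmx mulrC mulrA -det_mulmx mulmx1C //.
by rewrite det1 mul1r.
Qed.

Section Spectra.
Variable R : realType.
Local Notation C := R[i].
Implicit Types m : nat.

Definition has_spectrum m (X : 'M[C]_m) (s : 'I_m -> R) :=
  char_poly X = \prod_i ('X - ((s i)%:C%C)%:P).

Lemma perm_eigenvalues m (X : 'M[C]_m) s : has_spectrum X s ->
  perm_eq [seq complex.Re z | z <- eigenvalues X] [seq s i | i : 'I_m].
Proof.
rewrite /has_spectrum /eigenvalues; case: closed_field_poly_normal => e /= ->.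
rewrite (monicP (char_poly_monic X)) scale1r => E.
have {E}/prod_XsubC_eq/(perm_map (@complex.Re R)) : \prod_(z <- e) ('X - z%:P) =
    \prod_(z <- [seq (s i)%:C%C | i : 'I_m]) ('X - z%:P).
  by rewrite E big_image.
by rewrite -map_comp.
Qed.

Lemma sorted_sort_desc (s : seq R) : sorted >=%R (sort_desc s).
Proof. by apply: sort_sorted => x y; apply: le_total. Qed.

Lemma sort_desc_perm (s t : seq R) : perm_eq s t -> sort_desc s = sort_desc t.
Proof.
move=> st; apply/perm_sortP => //.
- by move=> x y; apply: le_total.
- by move=> y x z /= yx /le_trans; apply.
- by move=> x y /= /andP[yx xy]; apply: le_anti; rewrite xy.
Qed.

Lemma lambda_entries m (X : 'M[C]_m) s : has_spectrum X s ->
  [seq lambda X 0 i | i : 'I_m] = sort_desc [seq s i | i : 'I_m].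
Proof.
move=> /perm_eigenvalues Xs; have E := sort_desc_perm Xs.
apply: (@eq_from_nth _ 0) => [|i].
  by rewrite size_sort !size_map.
rewrite size_map -cardE card_ord => lt_im.
rewrite (nth_map (Ordinal lt_im)) ?size_enum_ord // mxE E.
by congr (nth _ _ _); rewrite nth_enum_ord.
Qed.

Lemma sum_largest_lambda m (X : 'M[C]_m) s k : has_spectrum X s ->
  sum_largest k (lambda X) =
  \sum_(t <- take k (sort_desc [seq s i | i : 'I_m])) t.
Proof.
move=> Xs; rewrite /sum_largest (lambda_entries Xs).
by rewrite (sort_desc_perm (t := [seq s i | i : 'I_m])) // perm_sort.
Qed.

Lemma sum_lambda m (X : 'M[C]_m) s : has_spectrum X s ->
  \sum_i lambda X 0 i = \sum_i s i.
Proof.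
move=> Xs; transitivity (\sum_(t <- [seq lambda X 0 i | i : 'I_m]) t).
  by rewrite big_image.
rewrite (lambda_entries Xs) (perm_big [seq s i | i : 'I_m]) ?big_image //.
by rewrite perm_sort.
Qed.

Lemma count_image (I : finType) (P : pred R) (s : I -> R) :
  count P [seq s i | i : I] = #|[pred i | P (s i)]|.
Proof.
rewrite count_map enumT cardE /enum_mem size_filter.
by apply: eq_count => i; rewrite /= inE.
Qed.

Lemma count_take_sorted (P : pred R) (s : seq R) k :
  (forall x y, x <= y -> P x -> P y) -> sorted >=%R s ->
  count P (take k s) = minn k (count P s).
Proof.
move=> P_homo; elim: s k => [|x s IH] [|k] //=; rewrite ?minn0 ?min0n //.
move=> xs; rewrite IH ?(path_sorted xs) //.
have [Px|nPx] := boolP (P x); first by rewrite !add1n minnSS.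
suff -> : count P s = 0%N by rewrite !minn0.
apply/eqP; rewrite -leqn0 leqNgt -has_count; apply/hasPn => y ys.
have yx : y <= x.
  move: xs; rewrite (path_sortedE _) => [/andP[/allP/(_ y ys)]|] //.
  by move=> b a c /= ab /le_trans; apply.
by apply: contra nPx; apply: P_homo yx.
Qed.

(** Each of the first k entries t is at most 1, plus 1 if it exceeds 1. *)
Lemma sum_take_le (s : seq R) k r :
  {in s, forall t, 0 <= t <= 2} -> (count [pred t : R | (1 < t)%R] s <= r)%N ->
  \sum_(t <- take k s) t <= (k + minn k r)%:R.
Proof.
move=> s02 le_r.
have sub t : t \in take k s -> t <= 2 by move=> /mem_take/s02/andP[].
have size_le : (size (take k s) <= k)%N by rewrite size_take_min geq_minl.
have count_le : (count [pred t : R | (1 < t)%R] (take k s) <= minn k r)%N.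
  rewrite leq_min (leq_trans (count_size _ _) size_le) (leq_trans _ le_r) //.
  by rewrite -[s in leqRHS](cat_take_drop k) count_cat leq_addr.
apply: (@le_trans _ _
  (size (take k s) + count [pred t : R | (1 < t)%R] (take k s))%:R); last first.
  by rewrite ler_nat leq_add.
elim: (take k s) sub => [|x u IH] /= sub; first by rewrite big_nil.
rewrite big_cons -add1n addnACA natrD lerD //.
  have x2 := sub x (mem_head _ _).
  by rewrite natrD; case: (ltP 1 x) => /= x1; lra.
by apply: IH => t tu; apply: sub; rewrite inE tu orbT.
Qed.

(** A value in {0, 1, 2} is the number of thresholds 1, 2 that it reaches, and in
a decreasing sequence the entries reaching a threshold come first. *)
Lemma sum_of_bool_pairs (I : finType) (p q : pred I) k :
  (\sum_(t <- take k (sort_desc [seq (p i + q i)%:R | i : I])) t : R) =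
  (minn k #|[pred i | p i || q i]| + minn k #|[pred i | p i && q i]|)%:R.
Proof.
set s := sort_desc _.
have s_perm : perm_eq s [seq (p i + q i)%:R | i : I] by rewrite perm_sort.
have countE j :
    count [pred t : R | (j.+1%:R <= t)%R] s = #|[pred i | j < p i + q i]%N|.
  rewrite (permP s_perm) count_image.
  by apply: eq_card => i; rewrite !inE /= ler_nat.
have count_take j : count [pred t : R | (j.+1%:R <= t)%R] (take k s) =
    minn k #|[pred i | j < p i + q i]%N|.
  rewrite -countE count_take_sorted // ?sorted_sort_desc //.
  by move=> x y xy /= /le_trans; apply.
have -> : #|[pred i | p i || q i]| = #|[pred i | 0 < p i + q i]%N|.
  by apply: eq_card => i; rewrite !inE; case: (p i); case: (q i).
have -> : #|[pred i | p i && q i]| = #|[pred i | 1 < p i + q i]%N|.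
  by apply: eq_card => i; rewrite !inE; case: (p i); case: (q i).
rewrite -!count_take.
have : {in take k s, forall t, exists i, t = (p i + q i)%:R}.
  move=> t /mem_take; rewrite (perm_mem s_perm) => /mapP[i _ ->].
  by exists i.
elim: (take k s) => [|x u IH] sub; first by rewrite big_nil.
rewrite big_cons IH /= => [|t tu]; last by apply: sub; rewrite inE tu orbT.
have [i ->] := sub x (mem_head _ _).
rewrite addnACA [RHS]natrD !ler_nat; congr (_%:R + _).
by case: (p i); case: (q i).
Qed.

(** * Sums of two orthogonal projectors *)

Lemma gram_ge0 m p (N : 'M[C]_(m, p)) i : 0 <= (N^t* *m N) i i.
Proof.
by rewrite mxE; apply: sumr_ge0 => j _; rewrite !mxE mulrC mul_conjC_ge0.
Qed.

Definition orthoprojector m (P : 'M[C]_m) := P^t* = P /\ P *m P = P.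

Lemma orthoprojector_ge0 m p (P : 'M[C]_m) (N : 'M_(m, p)) i :
  orthoprojector P -> 0 <= (N^t* *m P *m N) i i.
Proof.
move=> [Pt PP]; have := gram_ge0 (P *m N) i.
by rewrite trmx_mul map_mxM Pt mulmxA -[_ *m P *m P]mulmxA PP.
Qed.

Lemma orthoprojectorC m (P : 'M[C]_m) :
  orthoprojector P -> orthoprojector (1%:M - P).
Proof.
move=> [Pt PP]; split; first by rewrite linearB map_mxB /= Pt trmx1 map_mx1.
by rewrite mulmxBr !mulmxBl !mul1mx !mulmx1 PP subrr subr0.
Qed.

Lemma ker_colP (F : fieldType) p m (K : 'M[F]_(p, m)) :
  (\rank K < m)%N -> exists2 e : 'cV[F]_m, e != 0 & K *m e = 0.
Proof.
rewrite -mxrank_tr => lt_m; have : kermx K^T != 0.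
  by rewrite -mxrank_eq0 mxrank_ker subn_eq0 -ltnNge.
case/rowV0Pn => v /sub_kermxP vK nz; exists v^T; first by rewrite trmx_eq0.
by apply: trmx_inj; rewrite trmx_mul trmxK vK trmx0.
Qed.

(** The rank bound: if there were more eigenvalues above 1 than the rank of PQ,
some nonzero combination y of their eigenvectors would satisfy PQy = 0.  With
H = 1 - P - Q one has H^2 = H + PQ + QP, so <y, H y> = |H y|^2 >= 0, whereas
<y, H y> < 0 by the choice of the eigenvectors. *)
Lemma spectrum_add_orthoprojectors m (P Q : 'M[C]_m) :
  orthoprojector P -> orthoprojector Q ->
  exists s : 'I_m -> R,
  [/\ has_spectrum (P + Q) s, forall i, 0 <= s i <= 2,
      (#|[pred i | (1 < s i)%R]| <= \rank (P *m Q))%N &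
      (\sum_i s i)%:C%C = \tr (P + Q)].
Proof.
move=> hP hQ; have [[Pt PP] [Qt QQ]] := (hP, hQ).
pose X : 'M[C]_m := P + Q; rewrite -/X.
have Xt : X^t* = X by rewrite linearD map_mxD /= Pt Qt.
have X_herm : X \is hermsymmx.
  by apply/is_hermitianmxP; rewrite expr0 scale1r Xt.
have /orthomx_spectralP := hermitian_normalmx X_herm.
have /mxOverP D_real := hermitian_spectral_diag_real X_herm.
set V := spectralmx X in D_real *; set D := spectral_diag X in D_real *.
have V_unit : V \is unitarymx := spectral_unitarymx X.
have VVt : V *m V^t* = 1%:M by apply/unitarymxP.
rewrite invmx_unitary // => XE.
pose s i := complex.Re (D 0 i).
have sE i : (s i)%:C%C = D 0 i by apply/RRe_real/D_real.
have VXV : V *m X *m V^t* = diag_mx D.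
  by rewrite XE !mulmxA VVt mul1mx -mulmxA VVt mulmx1.
have VtK : (V^t*)^t* = V by apply: trmxCK.
have VC A : V *m (1%:M - A) *m V^t* = 1%:M - V *m A *m V^t*.
  by rewrite mulmxBr mulmx1 mulmxBl VVt.
have DE i : D 0 i = (V *m X *m V^t*) i i by rewrite VXV mxE eqxx.
exists s; split.
- rewrite /has_spectrum XE char_poly_conjugate; last exact: mulmx1C.
  rewrite char_poly_trig; last first.
    by apply/is_trig_mxP => i j lt_ij; rewrite mxE -val_eqE ltn_eqF.
  by apply: eq_bigr => i _; rewrite sE mxE eqxx.
- move=> i; rewrite -!(@lecR R) sE DE; apply/andP; split.
    rewrite /X mulmxDr mulmxDl mxE -{1 3}VtK.
    by rewrite addr_ge0 ?orthoprojector_ge0.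
  rewrite -subr_ge0.
  have -> : (2%:C)%C - (V *m X *m V^t*) i i =
     (V *m (1%:M - P) *m V^t*) i i + (V *m (1%:M - Q) *m V^t*) i i.
    rewrite !VC /X mulmxDr mulmxDl.
    move: (V *m P *m _) (V *m Q *m _) => A B.
    by rewrite !mxE eqxx rmorph_nat /= !mulr1n; ring.
  by rewrite -{1 3}VtK addr_ge0 ?orthoprojector_ge0 //; apply: orthoprojectorC.
- rewrite leqNgt; apply/negP; set T := [pred i | (1 < s i)%R] => lt_rank.
  (* e collects the coordinates of y in the eigenbasis; Z e = 0 says that they
     vanish outside T. *)
  pose Z : 'M[C]_(#|predC T|, m) := rowsub enum_val 1%:M.
  have [|e e_nz] := @ker_colP _ _ _ (col_mx (P *m Q *m V^t*) Z).
    rewrite -addsmxE (leq_ltn_trans (mxrank_adds_leqif _ _)) //.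
    rewrite -[X in (_ < X)%N](card_ord m) -(cardC T) -addSn.
    rewrite leq_add ?rank_leq_row //.
    by rewrite (leq_ltn_trans (mxrankM_maxl _ _)).
  rewrite mul_col_mx -[0]col_mx0 => /eq_col_mx[PQe Ze].
  have e0 i : i \notin T -> e i 0 = 0.
    move=> iT; have iT' : i \in predC T by rewrite !inE in iT *.
    have /matrixP/(_ (enum_rank_in iT' i) 0) := Ze.
    by rewrite mul_rowsub_mx mul1mx !mxE enum_rankK_in.
  have [y yE] : exists y, y = V^t* *m e by eexists.
  pose H : 'M[C]_m := 1%:M - X.
  have PQy : P *m Q *m y = 0 by rewrite yE mulmxA.
  have yQP : y^t* *m Q *m P = 0.
    have := congr1 (fun A => A^t*) PQy.
    by rewrite !trmx_mul !map_mxM Pt Qt trmx0 map_mx0 mulmxA.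
  have HH : H *m H = H + (P *m Q + Q *m P).
    rewrite {1}/H mulmxBl mul1mx; congr (_ + _).
    rewrite mulmxBr mulmx1 opprB {1 2}/X mulmxDl !mulmxDr PP QQ.
    by rewrite [Q *m P + Q]addrC addrACA -/X [X + _]addrC addrK.
  have Ht : H^t* = H by rewrite linearB map_mxB /= Xt trmx1 map_mx1.
  have := gram_ge0 (H *m y) 0.
  rewrite trmx_mul map_mxM Ht mulmxA -[_ *m H *m H]mulmxA HH.
  rewrite mulmxDr mulmxDr !mulmxA yQP addr0 mulmxDl.
  rewrite -[_ *m P *m Q]mulmxA -[_ *m (P *m Q) *m y]mulmxA PQy.
  rewrite mulmx0 addr0 {1}yE trmx_mul map_mxM VtK.
  have -> : e^t* *m V *m H *m y = e^t* *m (1%:M - diag_mx D) *m e.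
    by rewrite yE -VXV -VC !mulmxA.
  rewrite mulmxBr mulmx1 mul_mx_diag mxE.
  have [i ei] : exists i, e i 0 != 0.
    apply/existsP; apply: contra_neqT e_nz => /existsPn E.
    by apply/colP => i; rewrite mxE; apply/eqP/negPn/E.
  have iT : i \in T by apply: contraNT ei => /e0->.
  have termE j : (e^t* - (\matrix_(i0, j0) (e^t* i0 j0 * D 0 j0))) 0 j * e j 0 =
      (1 - s j)%:C%C * (e j 0 * (e j 0)^*).
    by rewrite !mxE -sE rmorphB rmorph1 /=; ring.
  apply/negP; rewrite lt_geF // (bigD1 i) //= ltr_wnDr //.
    apply: sumr_le0 => j _; rewrite termE.
    have [jT|/e0->] := boolP (j \in T); last by rewrite mul0r mulr0.
    rewrite mulr_le0_ge0 ?mul_conjC_ge0 // lecR subr_le0.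
    by move: jT; rewrite inE => /ltW.
  rewrite termE pmulr_llt0 ?mul_conjC_gt0 // ltcR subr_lt0.
  by move: iT; rewrite inE.
- rewrite XE mxtrace_mulC mulmxA VVt mul1mx mxtrace_diag rmorph_sum.
  by apply: eq_bigr => i _; apply: sE.
Qed.

End Spectra.

(** * The standard basis and the comparison *)

Section Standard.
Variables (R : realType) (n : nat) (d : 'I_n -> nat).
Local Notation T := (multi_index d).

Lemma card_enum_val_pred (I : finType) (P : pred I) :
  #|[pred k : 'I_#|{: I}| | P (enum_val k)]| = #|P|.
Proof.
rewrite -[LHS]sum1_card -[RHS]sum1_card.
transitivity (\sum_(x in I | P x) 1)%N; last by apply: eq_bigl => x.
by rewrite big_enum_val_cond.
Qed.

Lemma std_tensorE (x : T) k :
  std_tensor R x k 0 = (enum_val k == x :> T)%:R.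
Proof.
rewrite /std_tensor mxE; have [->|nx] := eqVneq (enum_val k : T) x.
  by rewrite big1 // => i _; rewrite mxE !eqxx.
have [i xi] : exists i, (enum_val k : T) i != x i.
  apply/existsP; apply: contra_neqT nx => /existsPn E.
  by apply/ffunP => i; apply/eqP/negPn/E.
by rewrite (bigD1 i) //= mxE (negPf xi) mul0r.
Qed.

Lemma proj_on_std (A : {set T}) :
  proj_on A (@std_tensor R n d) =
  diag_mx (\row_k ((enum_val k : T) \in A)%:R).
Proof.
apply/matrixP => k l; rewrite summxE !mxE.
have projE x : projector (std_tensor R x) k l =
    (enum_val k == x :> T)%:R * (enum_val l == x :> T)%:R.
  rewrite /projector mxE big_ord1 !mxE; congr (_ * _).
    by rewrite -std_tensorE mxE.
  by rewrite -[X in _ = X]conjC_nat -std_tensorE mxE.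
under eq_bigr do rewrite projE.
rewrite big_mkcond (bigD1 (enum_val k : T)) //= eqxx mul1r big1 => [|x nx].
  rewrite addr0 eq_sym (inj_eq enum_val_inj).
  by case: eqVneq => [->|_]; case: ifP; rewrite ?mulr0n.
by rewrite eq_sym (negPf nx) mul0r if_same.
Qed.

Lemma spectrum_std (A B : {set T}) :
  has_spectrum (proj_on A (@std_tensor R n d) + proj_on B (@std_tensor R n d))
    (fun k => (((enum_val k : T) \in A) + ((enum_val k : T) \in B))%:R).
Proof.
rewrite !proj_on_std -linearD /has_spectrum char_poly_trig; last first.
  by apply/is_trig_mxP => i j lt_ij; rewrite mxE -val_eqE ltn_eqF.
apply: eq_bigr => k _; congr ('X - _%:P).
by rewrite !mxE eqxx mulr1n -natrD (rmorph_nat (real_complex R)).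
Qed.

End Standard.

(** Up to the number of nonzero eigenvalues of Y, the bound comes from the count
of eigenvalues of X above 1; beyond it, Y has exhausted its trace, which equals
that of X. *)
Lemma majorized_by_bool_pairs (R : realType) m (X Y : 'M[R[i]]_m)
    (s : 'I_m -> R) (p q : pred 'I_m) :
  has_spectrum X s -> has_spectrum Y (fun i => (p i + q i)%:R) ->
  (forall i, 0 <= s i <= 2) ->
  (#|[pred i | (1 < s i)%R]| <= #|[pred i | p i && q i]|)%N ->
  \sum_i s i = (#|p| + #|q|)%:R ->
  majorized (lambda X) (lambda Y).
Proof.
move=> Xs Yt s02 s1 s_sum; split; last first.
  apply: etrans (sum_lambda Yt) (etrans _ (esym (sum_lambda Xs))).
  rewrite s_sum -natr_sum big_split /=.
  by rewrite -!big_mkcond /= !sum1_card.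
move=> k _.
rewrite [leLHS](sum_largest_lambda k Xs) [leRHS](sum_largest_lambda k Yt).
pose c := #|[pred i | p i || q i]|; pose r := #|[pred i | p i && q i]|.
have -> : \sum_(t <- take k (sort_desc [seq (p i + q i)%:R | i : 'I_m])) t =
    (minn k c + minn k r)%:R :> R.
  exact: sum_of_bool_pairs.
set u := sort_desc _.
have u_perm : perm_eq u [seq s i | i : 'I_m] by rewrite perm_sort.
have u02 : {in u, forall x, 0 <= x <= 2}.
  by move=> x; rewrite (perm_mem u_perm) => /mapP[i _ ->].
have [le_k|/ltnW ge_k] := leqP k c.
  apply: sum_take_le => //; apply: leq_trans s1.
  by rewrite (permP u_perm) count_image.
rewrite (minn_idPr _); last first.
  apply: leq_trans ge_k; apply: subset_leq_card; apply/subsetP => i.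
  by rewrite !inE => /andP[->].
have -> : (c + r = #|p| + #|q|)%N by apply: cardUI.
have -> : (#|p| + #|q|)%:R = \sum_(x <- u) x.
  by rewrite (perm_big _ u_perm) big_image -s_sum.
rewrite -[u in leRHS](cat_take_drop k) big_cat /= lerDl.
rewrite big_seq; apply: sumr_ge0 => x /mem_drop/u02.
by case/andP.
Qed.

Theorem theorem1p2 (R : realType) (n : nat) (d : 'I_n -> nat)
    (hn : (0 < n)%N) (hd : forall i, (0 < d i)%N)
    (a b : multi_index d -> 'cV[R[i]]_#|multi_index d|)
    (ha : tensor_onb a) (hb : tensor_onb b)
    (OmegaA OmegaB : {set multi_index d})
    (hA : downward_closed (@prod_le n d) OmegaA)
    (hB : downward_closed (@prod_le n d) OmegaB) :
  majorized
    (lambda (\sum_(x in OmegaA) projector (a x) +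
             \sum_(x in OmegaB) projector (b x)))
    (lambda (\sum_(x in OmegaA) projector (std_tensor R x) +
             \sum_(x in OmegaB) projector (std_tensor R x))).
Proof.
have orth A c : tensor_onb c -> orthoprojector (@proj_on R n d A c).
  by move=> hc; split; [apply: adj_proj_on|apply: idem_proj_on].
have [s [Xs s02 s1 s_tr]] :=
  spectrum_add_orthoprojectors (orth OmegaA a ha) (orth OmegaB b hb).
have Es := @spectrum_std R n d OmegaA OmegaB.
have s_sum : \sum_i s i = (#|OmegaA| + #|OmegaB|)%:R.
  apply: (@complexI R); rewrite s_tr mxtraceD !tr_proj_on // natrD rmorphD.
  by rewrite !rmorph_nat.
have card_val (A : {set multi_index d}) :
    #|[pred k : 'I_#|{: multi_index d}| |
        (enum_val k : multi_index d) \in A]| = #|A|.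
  exact: (card_enum_val_pred (fun x => x \in A)).
apply: (majorized_by_bool_pairs Xs Es) => //; last by rewrite !card_val.
apply: leq_trans s1 (leq_trans (rank_mul_proj_on ha hb hA hB) _).
rewrite -card_val; apply: subset_leq_card; apply/subsetP => k.
by rewrite !inE.
Qed.
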